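(* Let $q$ be an odd prime power and $k$ a positive integer. Let $G$ be an arc of $\mathrm{PG}_{k-1}(\mathbb{F}_q)$ with $|G|=3k-6$. Suppose that $E\subseteq G$ with $|E|=2k-3$, and that for every subset $D\subseteq E$ with $|D|=k-3$, the projection of $G$ from $D$ is contained in a conic. Then there is no arc of $\mathrm{PG}_{k-1}(\mathbb{F}_q)$ of size $q+2$ containing $G$.
   Context: An arc of $\mathrm{PG}_{k-1}(\mathbb{F}_q)$ (equivalently of $\mathrm{V}_k(\mathbb{F}_q)=\mathbb{F}_q^k$) is a set of points (vectors) such that every $k$ of them span the whole space (are linearly independent). For a subset $D$ of the arc with $|D|=k-3$, the projection of $G$ from $D$ is the set of points of the projective plane $\mathrm{PG}(\mathrm{V}_k(\mathbb{F}_q)/\langle D\rangle)\cong\mathrm{PG}_2(\mathbb{F}_q)$ determined by the vectors $g+\langle D\rangle$, $g\in G\setminus D$. A conic of $\mathrm{PG}_2(\mathbb{F}_q)$ is the set of zeros of a non-degenerate quadratic form in three variables (equivalently, a normal rational curve of $\mathrm{PG}_2(\mathbb{F}_q)$). *)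

(* Defs.v *)
From HB Require Import structures.
From mathcomp Require Import all_boot all_order all_algebra.

Set Implicit Arguments.
Unset Strict Implicit.
Unset Printing Implicit Defensive.

Import GRing.Theory.
Local Open Scope ring_scope.

Section FiniteVspace.
Import VectorInternalTheory.
Variables (F : finFieldType) (V : vectType F).
HB.instance Definition _ := [Countable of {vspace V} by <:].
HB.instance Definition _ := [Finite of {vspace V} by <:].
End FiniteVspace.

(* The points of PG(V) are the one-dimensional subspaces of V; PG_{k-1}(F) is
   PG(V) for V = 'rV[F]_k. *)
Definition points (F : finFieldType) (V : vectType F) : {set {vspace V}} :=
  [set P : {vspace V} | \dim P == 1%N].

Definition spanv (F : finFieldType) (V : vectType F) (S : {set {vspace V}}) :
    {vspace V} :=
  (\sum_(P in S) P)%VS.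

Definition is_arc (F : finFieldType) (k : nat) (G : {set {vspace 'rV[F]_k}}) :
    Prop :=
  G \subset points 'rV[F]_k /\
  (forall S : {set {vspace 'rV[F]_k}},
     S \subset G -> #|S| = k -> spanv S = fullv).

(* Every quadratic form in n variables is [qform A] for some matrix A, in any
   characteristic; A is not required to be symmetric. *)
Definition qform (F : fieldType) (n : nat) (A : 'M[F]_n) (x : 'rV[F]_n) : F :=
  (x *m A *m x^T) 0 0.

Definition polar (F : fieldType) (n : nat) (Q : 'rV[F]_n -> F)
    (x y : 'rV[F]_n) : F :=
  Q (x + y) - Q x - Q y.

(* Non-degeneracy of a quadratic form in arbitrary characteristic: no nonzero
   vector of the radical of the polar form is a zero of Q. When 2 is
   invertible, [polar Q x x = 2 * Q x], so this says that the polar form has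
   trivial radical. *)
Definition nondegenerate_qform (F : fieldType) (n : nat) (Q : 'rV[F]_n -> F) :
    Prop :=
  forall x, (forall y, polar Q x y = 0) -> Q x = 0 -> x = 0.

Definition is_conic (F : finFieldType) (C : {set {vspace 'rV[F]_3}}) : Prop :=
  exists2 A : 'M[F]_3, nondegenerate_qform (qform A) &
    C = [set P in points 'rV[F]_3 | [forall x in P, qform A x == 0]].

(* phi is the quotient map V -> V / U followed by a linear isomorphism
   V / U ~ F^3. *)
Definition quotient_coordinates (F : finFieldType) (V : vectType F)
    (U : {vspace V}) (phi : 'Hom(V, 'rV[F]_3)) : Prop :=
  lker phi = U /\ limg phi = fullv.

Definition projection (F : finFieldType) (V : vectType F)
    (phi : 'Hom(V, 'rV[F]_3)) (G D : {set {vspace V}}) :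
    {set {vspace 'rV[F]_3}} :=
  [set (phi @: P)%VS | P in G :\: D].

(* The choice of the isomorphism V / <D> ~ F^3 is immaterial, since linear
   changes of coordinates map conics to conics. *)
Definition projection_in_conic (F : finFieldType) (V : vectType F)
    (G D : {set {vspace V}}) : Prop :=
  exists phi : 'Hom(V, 'rV[F]_3),
    quotient_coordinates (spanv D) phi /\
    (exists2 C : {set {vspace 'rV[F]_3}},
       is_conic C & projection phi G D \subset C).

(* Main.v *)
From HB Require Import structures.
Require Import Defs.
From mathcomp Require Import all_boot all_order all_algebra.
From mathcomp Require Import all_fingroup all_solvable all_field.
From mathcomp Require Import ring zify.

(* Suppose that the arc [S] has size [q + 2] and contains [G], put [t = k - 3],
   and fix a subset [A] of [E] with [k - 2] elements.

   For [e] in [A], project from [A :\ e].  The image of [S] is a planar arc of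
   size [q + 2 - t], and [2 t + 3] of its points, among them [e], lie on a conic.
   Project the arc from a point [x] of the conic and identify the pencil of lines
   at [x] with the conic: the [t] points not covered are the roots of a
   polynomial [h x] of degree [t].  By Wilson's theorem the values of [h x] are,
   up to a constant, the reciprocals of products of determinants, and suitably
   scaled they satisfy [h x y = - h y x] on the conic points of the arc.  There
   are enough such points to interpolate in both variables separately, so that
   [h e e = 0] as [q] is odd; that is, the tangent to the conic at [e] meets the
   projected arc only in [e].

   Hence each [e] in [A] yields a hyperplane through [A] containing no further
   point of [S].  These hyperplanes are pairwise distinct, for otherwise
   [k] points of [G] would lie in a hyperplane.  Together with the [q + 4 - k]
   hyperplanes spanned by [A] and another point of [S] they are [q + 2]
   hyperplanes through the codimension-two space spanned by [A], which has only
   [q + 1] of them. *)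

Set Implicit Arguments.
Unset Strict Implicit.
Unset Printing Implicit Defensive.

Import GRing.Theory.
Local Open Scope ring_scope.

(** * Finite sets, Wilson's theorem and Lagrange interpolation *)

Lemma subset_of_card (I : finType) (A : {set I}) (n : nat) :
  (n <= #|A|)%N -> exists2 B : {set I}, B \subset A & #|B| = n.
Proof.
case/card_geqP => s [us ss sA]; exists [set x in s].
  by apply/subsetP => x; rewrite inE; exact: sA.
by rewrite cardsE (card_uniqP us).
Qed.

Lemma cardsD2 (I : finType) (A : {set I}) (x y : I) :
  x \in A -> y \in A -> x != y -> #|A| = #|A :\ x :\ y|.+2.
Proof.
move=> xA yA nxy.
by rewrite (cardsD1 x A) xA (cardsD1 y (A :\ x)) !inE eq_sym nxy yA.
Qed.

(** Wilson's theorem, moved from [0] to [b] by a translation of the index. *)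
Lemma prod_sub_finField (F : finFieldType) (b : F) :
  \prod_(c | c != b) (b - c) = -1.
Proof.
(* This is the factorization of ['X^q - 'X] with the factor ['X] cancelled; it is then evaluated at
   [0]. *)
have H : \prod_(x : F | x != 0) ('X - x%:P) = 'X^(#|F|.-1) - 1 :> {poly F}.
  have nzX : 'X != 0 :> {poly F} by rewrite polyX_eq0.
  apply: (mulfI nzX).
  have := finField_genPoly F; rewrite (bigD1 (0 : F)) //= subr0 => <-.
  by rewrite mulrBr mulr1 -exprS prednK // (ltn_trans _ (finNzRing_gt1 F)).
move/(congr1 (horner^~ 0)): H; rewrite horner_prod !hornerE expr0n.
rewrite -leqn0 leqNgt -subn1 subn_gt0 finNzRing_gt1 /= sub0r => <-.
rewrite (reindex (fun x : F => b + x)) /=; last first.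
  by exists (fun x => x - b) => x _; rewrite addrC ?addKr ?subrK.
apply: eq_big => x; first by rewrite -subr_eq0 addrAC subrr add0r.
by move=> _; rewrite hornerXsubC opprD addrA subrr.
Qed.

(** Top coefficients are compared in Lagrange's interpolation formula: each numerator [L z] is monic
    of degree [t]. *)
Lemma coef_lagrange (F : fieldType) (I : finType) (Z : {set I}) (b : I -> F)
    (t : nat) (p : {poly F}) :
    {in Z &, injective b} -> #|Z| = t.+1 -> (size p <= t.+1)%N ->
  p`_t = \sum_(z in Z) p.[b z] / \prod_(y in Z :\ z) (b z - b y).
Proof.
move=> bI cZ sp.
pose L z := \prod_(y in Z :\ z) ('X - (b y)%:P) : {poly F}.
have sL z : z \in Z -> size (L z) = t.+1.
  move=> zZ; rewrite /L -big_enum size_prod_XsubC -cardE.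
  by move: cZ; rewrite (cardsD1 z) zZ add1n => -[->].
have LE z x : (L z).[x] = \prod_(y in Z :\ z) (x - b y).
  by rewrite horner_prod; apply: eq_bigr => y _; rewrite !hornerE.
have L0 z y : y \in Z -> y != z -> (L z).[b y] = 0.
  by move=> yZ nyz; rewrite LE (bigD1 y) ?inE ?nyz //= subrr mul0r.
have Lz z : z \in Z -> (L z).[b z] != 0.
  move=> zZ; rewrite LE; apply/prodf_neq0 => y; rewrite !inE => /andP[nyz yZ].
  by rewrite subr_eq0; apply: contra nyz => /eqP /bI ->.
pose c z := p.[b z] / \prod_(y in Z :\ z) (b z - b y).
have Ep : p = \sum_(z in Z) c z *: L z.
  apply/eqP; rewrite -subr_eq0; apply/eqP.
  apply: (@roots_geq_poly_eq0 _ _ [seq b z | z <- enum Z]).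
  - apply/allP => _ /mapP[z zZ ->]; rewrite mem_enum in zZ.
    rewrite rootE hornerD hornerN horner_sum (bigD1 z) //= big1 => [|y /andP[yZ nyz]].
      by rewrite addr0 hornerZ /c -LE divfK ?subrr ?Lz.
    by rewrite hornerZ L0 ?mulr0 // eq_sym.
  - rewrite map_inj_in_uniq ?enum_uniq // => x y; rewrite !mem_enum; exact: bI.
  - rewrite size_map -cardE cZ (leq_trans (size_polyD _ _)) // geq_max sp size_polyN.
    apply: (leq_trans (size_sum _ _ _)); apply/bigmax_leqP => z zZ.
    by rewrite (leq_trans (size_scale_leq _ _)) ?sL.
rewrite {1}Ep coef_sum; apply: eq_bigr => z zZ; rewrite coefZ.
have := lead_coef_prod_XsubC (index_enum I) (mem (Z :\ z)) b.
by rewrite lead_coefE -/(L z) sL // => ->; rewrite mulr1.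
Qed.

(* For a biform [a(x, y) = (h x).[b y]] this says that an alternating form
   vanishes on the diagonal, here at the point at infinity, where evaluation
   of a polynomial of degree at most [t] means taking its [t]-th coefficient. *)
Lemma antisym_top_coef0 (F : fieldType) (I : finType) (Z Z' : {set I})
    (b : I -> F) (t : nat) (h : I -> {poly F}) (g : {poly F}) :
    (2 : F) != 0 ->
    {in Z &, injective b} -> {in Z' &, injective b} ->
    #|Z| = t.+1 -> #|Z'| = t.+1 ->
    (forall x, x \in Z :|: Z' -> (size (h x) <= t.+1)%N) ->
    (size g <= t.+1)%N ->
    (forall x y, x \in Z -> y \in Z' -> (h x).[b y] = - (h y).[b x]) ->
    (forall x, x \in Z :|: Z' -> g.[b x] = - (h x)`_t) ->
  g`_t = 0.
Proof.
move=> F2 bI bI' cZ cZ' sh sg ha hg.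
pose w (Y : {set I}) z := \prod_(y in Y :\ z) (b z - b y).
have E1 : g`_t = - \sum_(x in Z) \sum_(y in Z') (h x).[b y] / w Z' y / w Z x.
  rewrite (coef_lagrange bI cZ sg) -sumrN; apply: eq_bigr => x xZ.
  have xU : x \in Z :|: Z' by rewrite inE xZ.
  by rewrite hg // (coef_lagrange bI' cZ' (sh x xU)) -mulr_suml mulNr.
have E2 : g`_t = - \sum_(y in Z') \sum_(x in Z) (h y).[b x] / w Z x / w Z' y.
  rewrite (coef_lagrange bI' cZ' sg) -sumrN; apply: eq_bigr => x xZ.
  have xU : x \in Z :|: Z' by rewrite inE xZ orbT.
  by rewrite hg // (coef_lagrange bI cZ (sh x xU)) -mulr_suml mulNr.
(* [E1] interpolates on [Z] and then on [Z'], [E2] in the opposite order; by antisymmetry the two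
   double sums are opposite. *)
have E3 : g`_t = - g`_t.
  rewrite [LHS]E1 [in RHS]E2; congr (- _); rewrite exchange_big -sumrN /=.
  apply: eq_bigr => y yZ.
  rewrite -sumrN; apply: eq_bigr => x xZ.
  by rewrite ha // !mulNr; congr (- _); rewrite mulrAC.
apply/eqP; have /eqP := E3; rewrite -addr_eq0 -mulr2n -mulr_natl mulf_eq0.
by rewrite (negPf F2).
Qed.

(** When [r] is a parameter for the lines through a point of an arc and [T] consists of other points
    of the arc, the roots are the lines left uncovered by [T]. *)
Definition copoly (F : finFieldType) (I : finType) (T : {set I}) (r : I -> F) :
    {poly F} :=
  \prod_(c in ~: (r @: T)) ('X - c%:P).

Section Copoly.
Variables (F : finFieldType) (I : finType) (T : {set I}) (r : I -> F) (t : nat).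
Hypotheses (rI : {in T &, injective r}) (cT : (#|T| + t)%N = #|F|).

Lemma size_copoly : size (copoly T r) = t.+1.
Proof.
rewrite /copoly -big_enum size_prod_XsubC -cardE.
by have := cardsC (r @: T); rewrite card_in_imset // -cT => /addnI ->.
Qed.

Lemma coef_copoly : (copoly T r)`_t = 1.
Proof.
have := lead_coef_prod_XsubC (index_enum F) (mem (~: (r @: T))) id.
by rewrite lead_coefE -/(copoly T r) size_copoly.
Qed.

(** The field elements other than [r x] are the values missed by [r] on [T] and the values at
    [T :\ x]; Wilson's theorem gives the product of all the differences. *)
Lemma horner_copoly x : x \in T ->
  (copoly T r).[r x] * \prod_(s in T :\ x) (r x - r s) = -1.
Proof.
move=> xT; rewrite -(prod_sub_finField (r x)) horner_prod.
rewrite [RHS](bigID (mem (r @: T))) /= mulrC; congr (_ * _).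
  transitivity (\prod_(c in r @: (T :\ x)) (r x - c)).
    rewrite big_imset // => y z; rewrite !inE => /andP[_ yT] /andP[_ zT]; exact: rI.
  apply: eq_bigl => c; apply/imsetP/andP => [[y]|[nc /imsetP[y yT ec]]].
    rewrite !inE => /andP[nyx yT] ->; split; last exact: imset_f.
    by apply: contra nyx => /eqP /rI ->.
  by exists y; rewrite // !inE yT andbT; apply: contra nc => /eqP <-; rewrite ec.
apply: eq_big => [c|c _]; last by rewrite !hornerE.
rewrite !inE; case: (boolP (c \in _)) => [|/= nc]; rewrite ?andbF ?andbT //.
by apply/esym; apply: contraNneq nc => ->; exact: imset_f.
Qed.
End Copoly.

(** * Tangents of a planar arc sharing [2 t + 2] points besides [e] with a conic *)

Definition plane_arc (F : fieldType) (I : finType) (S : {set I})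
    (u0 u1 u2 : I -> F) : Prop :=
  forall (x y z : I) (c0 c1 c2 : F),
    x \in S -> y \in S -> z \in S -> x != y -> x != z -> y != z ->
    c0 * u0 x + c1 * u1 x + c2 * u2 x = 0 ->
    c0 * u0 y + c1 * u1 y + c2 * u2 y = 0 ->
    c0 * u0 z + c1 * u1 z + c2 * u2 z = 0 ->
  [/\ c0 = 0, c1 = 0 & c2 = 0].

Section TangentNormalized.
Variables (F : finFieldType) (I : finType) (S X : {set I}) (u0 u1 u2 : I -> F).
Variables (e : I) (t : nat).
Hypotheses (F2 : (2 : F) != 0) (arcS : plane_arc S u0 u1 u2).
Hypotheses (eS : e \in S) (XS : X \subset S :\ e).
Hypotheses (cS : (#|S| + t)%N = (#|F| + 2)%N) (cX : #|X| = (2 * t + 2)%N).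
Hypotheses (e0 : u0 e = 0) (e1 : u1 e = 0).
Hypotheses (X0 : forall x, x \in X -> u0 x = 1)
           (X2 : forall x, x \in X -> u2 x = u1 x ^+ 2).

Let XSP x : x \in X -> x \in S /\ x != e.
Proof. by move/(subsetP XS); rewrite !inE => /andP[]. Qed.

(** The form [u1 x * u0 - u1] defines the line joining [x] and [e]. *)
Let secant_neq0 x s : x \in X -> s \in S -> s != x -> s != e ->
  u1 x * u0 s - u1 s != 0.
Proof.
move=> xX sS nsx nse; have [xS nxe] := XSP xX; apply/eqP => H.
have [] := @arcS x s e (u1 x) (-1) 0 xS sS eS _ nxe nse.
- by rewrite eq_sym.
- by rewrite X0 //; ring.
- by rewrite mul0r addr0 mulN1r.
- by rewrite e0 e1; ring.
by move=> _ /eqP; rewrite oppr_eq0 oner_eq0.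
Qed.

Let u1I : {in X &, injective u1}.
Proof.
move=> x y xX yX Exy; apply/eqP/negPn/negP => nxy; have [yS nye] := XSP yX.
have := secant_neq0 xX yS _ nye; rewrite eq_sym nxy => /(_ isT).
by rewrite X0 // mulr1 Exy subrr eqxx.
Qed.

Let T x := S :\ x :\ e.

(* The parameter on the conic of the second intersection with the line joining
   [x] and [s]. *)
Let r x s := (u2 s - u1 x * u1 s) / (u1 s - u1 x * u0 s).

Let TP x s : s \in T x -> [/\ s \in S, s != x & s != e].
Proof. by rewrite !inE => /and3P[]. Qed.

Let rI x : x \in X -> {in T x &, injective (r x)}.
Proof.
move=> xX s s' /TP[sS nsx nse] /TP[sS' nsx' nse'] Er.
have [xS nxe] := XSP xX.
have d0 : u1 s - u1 x * u0 s != 0.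
  by rewrite -oppr_eq0 opprB; exact: secant_neq0.
have d0' : u1 s' - u1 x * u0 s' != 0.
  by rewrite -oppr_eq0 opprB; exact: secant_neq0.
apply/eqP/negPn/negP => nss.
have {Er} /eqP Er := Er; rewrite /r eqr_div // in Er; move/eqP: Er => Er.
(* The coefficients are those of the chord from [x] to the conic point of parameter [r x s], with
   the denominator cleared. *)
have [] := @arcS x s s' (u1 x * (u2 s - u1 x * u1 s))
  (- u1 x * (u1 s - u1 x * u0 s) - (u2 s - u1 x * u1 s))
  (u1 s - u1 x * u0 s) xS sS sS' _ _ nss.
- by rewrite eq_sym.
- by rewrite eq_sym.
- by rewrite (X0 xX) (X2 xX); ring.
- by ring.
- transitivity ((u2 s' - u1 x * u1 s') * (u1 s - u1 x * u0 s)
    - (u2 s - u1 x * u1 s) * (u1 s' - u1 x * u0 s')); first by ring.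
  by rewrite Er subrr.
by move=> _ _ /eqP; rewrite (negPf d0).
Qed.

Let cT x : x \in X -> (#|T x| + t)%N = #|F|.
Proof.
move=> xX; have [xS nxe] := XSP xX.
by move: cS; rewrite (cardsD2 xS eS nxe) addn2 !addSn => -[].
Qed.

Let lam x := \prod_(s in T x) (u1 x * u0 s - u1 s).

Let lam_neq0 x : x \in X -> lam x != 0.
Proof.
by move=> xX; apply/prodf_neq0 => s /TP[sS nsx nse]; exact: secant_neq0.
Qed.

(** The factor [lam x] cancels the denominators of [r x], which are not symmetric in the two conic
    points. *)
Let h x := (lam x)^-1 *: copoly (T x) (r x).

(** The equation of the chord through the conic points [x] and [y], evaluated at [s]; it is
    symmetric in [x] and [y]. *)
Let K x y s := u2 s - (u1 x + u1 y) * u1 s + u1 x * u1 y * u0 s.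

(** [K x y s] is [u1 x * u0 s - u1 s], a factor of [lam x], times [u1 y - r x s], a factor in
    [horner_copoly]. The remaining factor of [lam x], at [s = y], is [u1 x - u1 y]. *)
Let hE x y : x \in X -> y \in X -> x != y ->
  (h x).[u1 y] = - ((u1 x - u1 y) * \prod_(s in T x :\ y) K x y s)^-1.
Proof.
move=> xX yX nxy; have [yS nye] := XSP yX.
have yT : y \in T x by rewrite !inE nye yS eq_sym nxy.
have ab : u1 x - u1 y != 0.
  by rewrite subr_eq0; apply: contra nxy => /eqP /u1I ->.
have ry : r x y = u1 y.
  rewrite /r X0 // X2 // mulr1 expr2 -mulrBl mulrC mulKf //.
  by rewrite -oppr_eq0 opprB.
have := horner_copoly (rI xX) yT; rewrite ry.
have KE : \prod_(s in T x :\ y) K x y s =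
    \prod_(s in T x :\ y) (u1 x * u0 s - u1 s) *
    \prod_(s in T x :\ y) (u1 y - r x s).
  rewrite -big_split; apply: eq_bigr => s /setD1P[_ /TP[sS nsx nse]] /=.
  have d := secant_neq0 xX sS nsx nse.
  rewrite /K /r; field.
  by rewrite -oppr_eq0 opprB.
have lamE : lam x = (u1 x - u1 y) * \prod_(s in T x :\ y) (u1 x * u0 s - u1 s).
  rewrite /lam (big_setD1 y) //=; congr (_ * _).
  by rewrite X0 // mulr1.
have := lam_neq0 xX; rewrite lamE mulf_eq0 (negPf ab) /= => P0.
rewrite KE hornerZ lamE.
set c := (copoly _ _).[_]; set p1 := \prod_(s in _) _ in P0 *.
set p2 := \prod_(s in _) _ => Ec.
have p20 : p2 != 0.
  by apply: contra_eq_neq Ec => ->; rewrite mulr0 eq_sym oppr_eq0 oner_eq0.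
have -> : c = - p2^-1 by rewrite -[LHS](mulfK p20) Ec mulN1r.
by field; rewrite ab P0 p20.
Qed.

(** In [hE] only the factor [u1 x - u1 y] changes when [x] and [y] are exchanged. *)
Let h_antisym x y : x \in X -> y \in X -> x != y ->
  (h x).[u1 y] = - (h y).[u1 x].
Proof.
move=> xX yX nxy; rewrite !hE //; last by rewrite eq_sym.
rewrite -[u1 x - u1 y]opprB mulNr invrN opprK opprK; congr (_ * _)^-1.
apply: eq_big => s; first by rewrite !inE; do !case: (_ != _).
by move=> _; rewrite /K; ring.
Qed.

Let h_top x : x \in X -> (h x)`_t = (lam x)^-1.
Proof. by move=> xX; rewrite coefZ (coef_copoly (rI xX) (cT xX)) mulr1. Qed.

(** If [s] were on the tangent [u0 = 0] at [e], the polynomial [g] attached to [e] would have degree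
    exactly [t], while antisymmetry kills its top coefficient. The point [e] has parameter infinity
    on the conic. *)
Lemma tangent_normalized s : s \in S :\ e -> u0 s != 0.
Proof.
move=> /setD1P[nse sS]; apply/eqP => s0.
have nsX x : x \in X -> x != s.
  by move=> xX; apply/eqP => E; move: s0; rewrite -E X0 //; apply/eqP; rewrite oner_eq0.
(* [r'] parametrizes the lines through [e]; the tangent has parameter infinity and is accounted for
   by [s]. *)
pose T' := S :\ e :\ s; pose r' z := u1 z / u0 z.
have TP' z : z \in T' -> [/\ z \in S, z != s & z != e].
  by rewrite !inE => /and3P[].
have s1 : u1 s != 0.
  have [x xX] : exists x, x \in X by apply/set0Pn; rewrite -card_gt0 cX addn2.
  have := secant_neq0 xX sS _ nse; rewrite s0 mulr0 sub0r oppr_eq0; apply.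
  by rewrite eq_sym nsX.
have z0 z : z \in T' -> u0 z != 0.
  move=> /TP'[zS nzs nze]; apply/eqP => z0.
  have [] := @arcS z s e 1 0 0 zS sS eS nzs nze nse; rewrite ?z0 ?s0 ?e0; try ring.
  by move/eqP; rewrite oner_eq0.
have rI' : {in T' &, injective r'}.
  move=> y z yT zT; have [yS nys nye] := TP' _ yT; have [zS nzs nze] := TP' _ zT.
  have y0 := z0 _ yT; have z0' := z0 _ zT.
  rewrite /r' => /eqP; rewrite eqr_div // => /eqP E.
  apply/eqP/negPn/negP => nyz.
  have [] := @arcS y z e (u1 y) (- u0 y) 0 yS zS eS nyz nye nze.
  - by ring.
  - by rewrite E; ring.
  - by rewrite e0 e1; ring.
  by move=> _ /eqP; rewrite oppr_eq0 (negPf y0).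
have cT' : (#|T'| + t)%N = #|F|.
  by move: cS; rewrite (cardsD2 eS sS) 1?eq_sym // addn2 !addSn => -[].
pose kap := \prod_(z in T') u0 z.
have kap0 : kap != 0 by apply/prodf_neq0 => z /z0.
pose g := - (u1 s * kap)^-1 *: copoly T' r'.
have gt0 : g`_t != 0.
  by rewrite coefZ (coef_copoly rI' cT') mulr1 oppr_eq0 invr_eq0 mulf_neq0.
(* This is the antisymmetry between [e] and [x]: the value of [h x] at [e] is its coefficient of
   degree [t]. *)
have gE x : x \in X -> g.[u1 x] = - (h x)`_t.
  move=> xX; have [xS nxe] := XSP xX; rewrite h_top //.
  have xT : x \in T' by rewrite !inE nsX // nxe.
  have rx : r' x = u1 x by rewrite /r' X0 // divr1.
  have := horner_copoly rI' xT; rewrite rx.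
  have lamE : lam x = - u1 s * (kap * \prod_(z in T' :\ x) (u1 x - r' z)).
    rewrite /lam (big_setD1 s) /=; last by rewrite !inE nse sS eq_sym nsX.
    rewrite s0 mulr0 sub0r; congr (_ * _).
    rewrite /kap (big_setD1 x xT) /= (X0 xX) mul1r -big_split /=.
    apply: eq_big => [z|z]; first by rewrite !inE; do !case: (_ != _).
    rewrite !inE => /and4P[nzs nze nzx zS].
    have z0' : u0 z != 0 by apply: z0; rewrite !inE nzs nze.
    by rewrite /r'; field.
  have := lam_neq0 xX; rewrite lamE.
  set c := (copoly _ _).[_]; set p := \prod_(z in _) _.
  rewrite !mulf_eq0 oppr_eq0 !negb_or => /and3P[_ _ p0] Ec.
  rewrite /g hornerZ -/c.
  have -> : c = - p^-1 by rewrite -[LHS](mulfK p0) Ec mulN1r.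
  by field; rewrite oppr_eq0 s1 kap0 p0.
(* Two disjoint halves of [t + 1] points suffice for interpolation, and [h x] is never evaluated at
   [x] itself. *)
have [|Z ZX cZ] := @subset_of_card _ X t.+1; first by rewrite cX; lia.
have cZ' : #|X :\: Z| = t.+1 by rewrite cardsD (setIidPr ZX) cX cZ; lia.
have ZU x : x \in Z :|: X :\: Z -> x \in X.
  by rewrite !inE => /orP[/(subsetP ZX) //|/andP[]].
have sh x : x \in X -> (size (h x) <= t.+1)%N.
  by move=> xX; rewrite (leq_trans (size_scale_leq _ _)) // (size_copoly (rI xX) (cT xX)).
case/negP: gt0; apply/eqP.
apply: (antisym_top_coef0 F2 _ _ cZ cZ' (h := h) (b := u1)).
- by move=> x y /(subsetP ZX) xX /(subsetP ZX) yX; exact: u1I.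
- by move=> x y /setDP[xX _] /setDP[yX _]; exact: u1I.
- by move=> x /ZU; exact: sh.
- by rewrite (leq_trans (size_scale_leq _ _)) // (size_copoly rI' cT').
- move=> x y xZ /setDP[yX nyZ]; rewrite h_antisym ?(subsetP ZX x xZ) //.
  by apply: contraNneq nyZ => <-.
- by move=> x /ZU; exact: gE.
Qed.

End TangentNormalized.

(** * Normal form of a conic at one of its points *)

Section ConicCoordinates.
Variables (F : finFieldType) (A : 'M[F]_3).

Let f (x y : 'rV[F]_3) : F := (x *m A *m y^T) 0 0.

Let fDl x y z : f (x + y) z = f x z + f y z.
Proof. by rewrite /f !mulmxDl [LHS]mxE. Qed.

Let fDr x y z : f z (x + y) = f z x + f z y.
Proof. by rewrite /f linearD mulmxDr [LHS]mxE. Qed.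

Let fZl a x z : f (a *: x) z = a * f x z.
Proof. by rewrite /f -!scalemxAl [LHS]mxE. Qed.

Let fZr a x z : f z (a *: x) = a * f z x.
Proof. by rewrite /f linearZ -scalemxAr [LHS]mxE. Qed.

Let qE x : qform A x = f x x. Proof. by []. Qed.

Let polarE x y : polar (qform A) x y = f x y + f y x.
Proof. by rewrite /polar !qE !(fDl, fDr); ring. Qed.

Let fE := (fDl, fDr, fZl, fZr).

(** The vector [e] is completed to a hyperbolic pair [e], [g], and then to a basis by a vector [d]
    orthogonal to both. *)
Lemma conic_coordinates (e : 'rV[F]_3) :
    (2 : F) != 0 -> nondegenerate_qform (qform A) -> e != 0 -> qform A e = 0 ->
  exists2 P : 'M[F]_3, P \in unitmx & row 2 P = e /\
    forall c : 'rV[F]_3, qform A (c *m P) = 0 -> c 0 1 ^+ 2 = c 0 0 * c 0 2.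
Proof.
move=> F2 nd e0 qe.
have [f0 ef0] : exists y, polar (qform A) e y != 0.
  apply/existsP; apply: contraR e0 => /existsPn H; apply/eqP/nd => // y.
  by apply/eqP; have := H y; rewrite negbK.
rewrite polarE in ef0; rewrite qE in qe.
(* After scaling, subtracting [a *: e] from [f1] lowers the value of the form by [a], so that [g] is
   a zero. *)
pose f1 := (f e f0 + f f0 e)^-1 *: f0; pose g := f1 - f f1 f1 *: e.
have ef1 : f e f1 + f f1 e = 1 by rewrite !fE -mulrDr mulVf.
have Bge : f e g + f g e = 1.
  by rewrite -ef1 /g -scaleNr; rewrite !fE qe; ring.
have qg : f g g = 0.
  transitivity (f f1 f1 * (1 - (f e f1 + f f1 e))); last by rewrite ef1 subrr mulr0.
  by rewrite /g -scaleNr !(fDl, fDr) !fZl !fZr qe; ring.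
clearbody g.
have [d d0 [Bde Bdg]] : exists2 d, d != 0 & f d e + f e d = 0 /\ f d g + f g d = 0.
  pose N := row_mx ((A + A^T) *m e^T) ((A + A^T) *m g^T).
  have kN : kermx N != 0.
    by rewrite -mxrank_eq0 mxrank_ker subn_eq0 -ltnNge ltnS rank_leq_col.
  have dN : nz_row (kermx N) *m N = 0 by apply/sub_kermxP; exact: nz_row_sub.
  exists (nz_row (kermx N)); first by rewrite nz_row_eq0.
  move: (nz_row _) dN => d; rewrite mul_mx_row -[0]row_mx0 => /eq_row_mx[].
  have tr y : f d y + f y d = (d *m ((A + A^T) *m y^T)) 0 0.
    rewrite mulmxDl mulmxDr [RHS]mxE mulmxA; congr (_ + _).
    have -> : d *m (A^T *m y^T) = (y *m A *m d^T)^T by rewrite !trmx_mul trmxK.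
    by rewrite [RHS]mxE.
  by rewrite !tr => -> ->; rewrite mxE.
(* The scale [k] is [1] in the proof that [f d d != 0], and [- f d d] in the final basis, where the
   form becomes [f d d] times [c 0 1 ^+ 2 - c 0 0 * c 0 2]. *)
pose P (k : F) : 'M[F]_3 := \matrix_(i < 3) [:: k *: g; d; e]`_i.
have PE k (c : 'rV_3) :
    c *m P k = (c 0 0 * k) *: g + c 0 1 *: d + c 0 2 *: e.
  rewrite mulmx_sum_row !big_ord_recl big_ord0 addr0 !rowK /= scalerA addrA.
  by congr (_ + _ *: _ + _ *: _); congr (c _ _); apply/val_inj.
have P_unit k : k != 0 -> P k \in unitmx.
  move=> k0; rewrite -row_free_unit; apply: inj_row_free => c; rewrite PE => Ec.
  have Bc y : f y 0 + f 0 y = 0 by rewrite -(scale0r 0) fZl fZr !mul0r addr0.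
  have c0 : c 0 0 = 0.
    apply: (mulIf k0); rewrite mul0r -(Bc e) -Ec !fE.
    transitivity (c 0 0 * k * (f e g + f g e) + c 0 1 * (f d e + f e d)
      + c 0 2 * (f e e + f e e)); last by ring.
    by rewrite Bge Bde qe; ring.
  have c2 : c 0 2 = 0.
    rewrite -(Bc g) -Ec !fE c0.
    transitivity (c 0 2 * (f e g + f g e) + c 0 1 * (f d g + f g d)); last by ring.
    by rewrite Bge Bdg; ring.
  move: Ec; rewrite c0 c2 mul0r !scale0r add0r addr0 => /eqP.
  rewrite scaler_eq0 (negPf d0) orbF => /eqP c1.
  apply/rowP => i; rewrite mxE.
  by case: i => [[|[|[|//]]] ?]; [rewrite -c0|rewrite -c1|rewrite -c2]; congr (c _ _); apply/val_inj.
have dd : f d d != 0.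
  apply: contra d0 => /eqP qd; apply/eqP/nd => // y.
  rewrite polarE -[y](mulmxKV (P_unit 1 (oner_neq0 F))) PE !fE.
  set c := _ *m invmx _.
  transitivity (c 0 0 * 1 * (f d g + f g d) + c 0 2 * (f d e + f e d)
    + c 0 1 * (f d d + f d d)); first by ring.
  by rewrite Bdg Bde qd; ring.
exists (P (- f d d)); first by rewrite P_unit // oppr_eq0.
split; first by rewrite rowK.
move=> c; rewrite PE qE !fE => E.
apply/eqP; rewrite -subr_eq0 -(mulrI_eq0 _ (lregP dd)) -E; apply/eqP.
transitivity (f d d * (c 0 1 ^+ 2 - c 0 0 * c 0 2 * (f e g + f g e))
  + (c 0 0 * f d d) ^+ 2 * f g g + (c 0 2)^+2 * f e e
  + c 0 1 * c 0 2 * (f d e + f e d) - c 0 0 * f d d * c 0 1 * (f d g + f g d));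
  first by rewrite Bge qg qe Bde Bdg; ring.
by ring.
Qed.
End ConicCoordinates.

(** * Tangent hyperplanes through [A] and the final count *)

Section Frames.
Variables (F : finFieldType) (k : nat) (I : finType) (v : I -> 'rV[F]_k).
Variables (S A X : {set I}).

Definition ev (l : 'cV[F]_k) (P : I) : F := (v P *m l) 0 0.

Lemma evD l m P : ev (l + m) P = ev l P + ev m P.
Proof. by rewrite /ev mulmxDr [LHS]mxE. Qed.

Lemma evZ a l P : ev (a *: l) P = a * ev l P.
Proof. by rewrite /ev -scalemxAr [LHS]mxE. Qed.

Lemma ev0 P : ev 0 P = 0.
Proof. by rewrite /ev mulmx0 mxE. Qed.

Definition evE := (evD, evZ, ev0).

(* [l 0], [l 1], [l 2] are coordinates on the quotient by [A :\ e] in which the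
   conic is [y ^ 2 = x z] and [e] is the point [(0 : 0 : 1)], so that [l 0]
   defines the tangent to the conic at [e]. *)
Definition frame (e : I) (l : nat -> 'cV[F]_k) : Prop :=
  [/\ forall P i, P \in A :\ e -> ev (l i) P = 0,
      [/\ ev (l 0) e = 0, ev (l 1) e = 0 & ev (l 2) e != 0],
      forall c0 c1 c2, c0 *: l 0 + c1 *: l 1 + c2 *: l 2 = 0 ->
        [/\ c0 = 0, c1 = 0 & c2 = 0] &
      forall x, x \in X -> ev (l 1) x ^+ 2 = ev (l 0) x * ev (l 2) x].

Hypothesis arcS : forall (Y : {set I}) l, Y \subset S -> (k <= #|Y|)%N ->
  (forall P, P \in Y -> ev l P = 0) -> l = 0.
Hypotheses (F2 : (2 : F) != 0) (AS : A \subset S) (XS : X \subset S :\: A).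
Hypotheses (cS : #|S| = (#|F| + 2)%N) (cA : (#|A| + 2)%N = k)
  (cX : (#|X| + 4)%N = (2 * k)%N) (k3 : (2 < k)%N).

Let XSP x : x \in X -> x \in S /\ x \notin A.
Proof. by move/(subsetP XS); rewrite inE => /andP[]. Qed.

Lemma frame_zero e l P : frame e l -> P \in A -> ev (l 0) P = 0 /\ ev (l 1) P = 0.
Proof.
move=> [Hz [He0 He1 _] _ _] PA; case: (eqVneq P e) => [->|ne]; first by split.
by rewrite !Hz // !inE ne.
Qed.

(** This is [tangent_normalized] with [t = k - 3], applied to the projection from [A :\ e]. *)
Lemma frame_tangent e l s : e \in A -> frame e l -> s \in S :\: A ->
  ev (l 0) s != 0.
Proof.
move=> eA [Hz [He0 He1 He2] Hi Hc] sSA.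
have eS := subsetP AS _ eA.
(* Scaling by [w] makes the first coordinate [1] on [X]; the default [1] keeps the factor nonzero on
   the tangent. *)
pose w P := if ev (l 0) P == 0 then 1 else (ev (l 0) P)^-1.
have w0 P : w P != 0 by rewrite /w; case: ifP => [_|/negbT]; rewrite ?oner_eq0 ?invr_eq0.
pose u i P := ev (l i) P * w P.
pose S' := S :\: (A :\ e).
have S'S x : x \in S' -> x \in S by case/setDP.
have eS' : e \in S' by rewrite !inE eqxx eS.
have cD : (#|A :\ e| + 3)%N = k by rewrite -cA (cardsD1 e A) eA add1n addSnnS.
have arc' : plane_arc S' (u 0%N) (u 1%N) (u 2%N).
  move=> x y z c0 c1 c2 xS yS zS nxy nxz nyz Ex Ey Ez.
  apply: Hi; apply: (arcS (Y := (A :\ e) :|: [set x; y; z])).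
  - apply/subsetP => P; rewrite !inE => /orP[/andP[_]|]; first exact: subsetP AS P.
    by move=> /orP[/orP[]|] /eqP ->; exact: S'S.
  - rewrite cardsU (_ : _ :&: _ = set0).
      rewrite cards0 subn0 -setUA cardsU1 !inE negb_or nxy nxz cards2 nyz /=.
      by rewrite -{1}cD.
    apply/setP => P; rewrite in_setI in_set0; apply/negP => /andP[PA].
    by rewrite !inE => /orP[/orP[]|] /eqP E; move: PA; rewrite E => PA;
      [case/setDP: xS|case/setDP: yS|case/setDP: zS] => _; rewrite PA.
  have red P : c0 * u 0%N P + c1 * u 1%N P + c2 * u 2%N P = 0 ->
      ev (c0 *: l 0 + c1 *: l 1 + c2 *: l 2) P = 0.
    move=> E; apply: (mulIf (w0 P)); rewrite mul0r -E !evE /u; ring.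
  move=> P; rewrite in_setU => /orP[PA|]; first by rewrite !evE !Hz //; ring.
  by rewrite !inE => /orP[/orP[]|] /eqP ->; exact: red.
have XS' x : x \in X -> x \in S' /\ x != e.
  move=> xX; have [xS xA] := XSP xX; rewrite !inE (negPf xA) andbF xS.
  by split=> //; apply: contraNneq xA => ->.
have e0 : u 0%N e = 0 by rewrite /u He0 mul0r.
have e1 : u 1%N e = 0 by rewrite /u He1 mul0r.
(* A conic point on the tangent at [e] would project to [e], hence be collinear with [e] and any
   further point [y] of [X]. *)
have X0 x : x \in X -> ev (l 0) x != 0.
  move=> xX; apply/eqP => x0; have [xS nxe] := XS' _ xX.
  have x1 : ev (l 1) x = 0.
    by have /eqP := Hc _ xX; rewrite x0 mul0r expf_eq0 /= => /eqP.
  have [y] : exists y, y \in X :\ x.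
    apply/set0Pn; rewrite -card_gt0; have := cardsD1 x X; rewrite xX.
    by move: cX k3; lia.
  case/setD1P => nyx yX; have [yS nye] := XS' _ yX.
  rewrite eq_sym in nyx; rewrite eq_sym in nxe; rewrite eq_sym in nye.
  have ux0 : u 0%N x = 0 by rewrite /u x0 mul0r.
  have ux1 : u 1%N x = 0 by rewrite /u x1 mul0r.
  have [] := arc' e x y (u 1%N y) (- u 0%N y) 0 eS' xS yS nxe nye nyx;
    rewrite ?e0 ?e1 ?ux0 ?ux1; try ring.
  move=> _ /eqP; rewrite oppr_eq0 => /eqP uy0 _.
  have [] := arc' e x y 1 0 0 eS' xS yS nxe nye nyx;
    rewrite ?e0 ?e1 ?ux0 ?ux1 ?uy0; try ring.
  by move/eqP; rewrite oner_eq0.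
have : u 0%N s != 0.
  apply: (tangent_normalized (t := (k - 3)%N) F2 arc' eS' (X := X)) => //.
  - by apply/subsetP => x /XS'[xS nxe]; rewrite in_setD1 nxe.
  - have DS : A :\ e \subset S by rewrite (subset_trans (subsetDl _ _)).
    by rewrite cardsD (setIidPr DS) cS; have := subset_leq_card DS; move: cD cS; lia.
  - by move: cX k3; lia.
  - by move=> x /X0 x0; rewrite /u /w (negPf x0) mulfV.
  - move=> x xX; have x0 := X0 _ xX; rewrite /u /w (negPf x0).
    by rewrite exprMn Hc //; field.
  - case/setDP: sSA => sS sA; rewrite !inE sS (negPf sA) andbF /= andbT.
    by apply: contraNneq sA => ->.
by rewrite mulf_eq0 negb_or => /andP[].
Qed.

(** A form vanishing on [A] is determined by its values at two points [p], [r] of [X], since [A] has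
    [k - 2] points; the coefficients come from Cramer's rule. *)
Lemma frame_span e l m : e \in A -> frame e l ->
    (forall P, P \in A -> ev m P = 0) ->
  exists a b, m = a *: l 0 + b *: l 1.
Proof.
move=> eA fl mA; have [Hz [He0 He1 _] Hi Hc] := fl.
have [p [r [pX rX npr]]] : exists p r, [/\ p \in X, r \in X & p != r].
  have : (1 < #|X|)%N by move: cX k3; lia.
  by case/card_gt1P => p [r [? ? ?]]; exists p, r.
have arc2 n : (forall P, P \in A -> ev n P = 0) -> ev n p = 0 -> ev n r = 0 -> n = 0.
  move=> nA np nr; apply: (arcS (Y := A :|: [set p; r])).
  - apply/subsetP => P; rewrite !inE => /orP[|/orP[]/eqP->]; first exact: subsetP AS P.
      by case: (XSP pX).
    by case: (XSP rX).
  - rewrite cardsU (_ : _ :&: _ = set0) ?cards0 ?subn0 ?cards2 ?npr ?cA //.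
    apply/setP => P; rewrite !inE; apply/negP => /andP[PA /orP[]/eqP E].
      by have [_] := XSP pX; rewrite -E PA.
    by have [_] := XSP rX; rewrite -E PA.
  by move=> P; rewrite !inE => /orP[/nA //|/orP[]/eqP->].
pose d := ev (l 0) p * ev (l 1) r - ev (l 1) p * ev (l 0) r.
have pSA := subsetP XS _ pX.
have d0 : d != 0.
  apply/eqP => d0.
  have /Hi[_ /eqP] : - ev (l 1) p *: l 0 + ev (l 0) p *: l 1 + 0 *: l 2 = 0.
    apply: arc2 => [P PA||]; rewrite !evE.
    - by have [-> ->] := frame_zero fl PA; ring.
    - by ring.
    - by rewrite -[RHS]d0 /d; ring.
  by rewrite (negPf (frame_tangent eA fl pSA)).
exists ((ev m p * ev (l 1) r - ev m r * ev (l 1) p) / d).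
exists ((ev (l 0) p * ev m r - ev (l 0) r * ev m p) / d).
apply/eqP; rewrite -subr_eq0 -scaleN1r; apply/eqP.
apply: arc2 => [P PA||]; rewrite !evE.
- by have [-> ->] := frame_zero fl PA; rewrite mA //; ring.
- by move: d0; rewrite /d => d0; field.
- by move: d0; rewrite /d => d0; field.
Qed.

(* Two distinct quadratic cones with vertices [e] and [e'], both tangent to the
   same plane along the line [e e'], would meet residually in a plane conic
   containing the whole of [X]. *)
Lemma frame_tangent_neq e e' l l' c : e \in A -> e' \in A -> e != e' ->
  frame e l -> frame e' l' -> l' 0%N <> c *: l 0.
Proof.
move=> eA eA' nee fl fl' E0.
have [Hz [He0 He1 He2] Hi Hc] := fl; have [Hz' [He0' He1' He2'] Hi' Hc'] := fl'.
have c0 : c != 0.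
  apply/eqP => c0; have [|/eqP] := Hi' 1 0 0; last by rewrite oner_eq0.
  by rewrite E0 c0 !scale0r scaler0 !addr0.
have [m [n E1]] := frame_span eA fl (fun P PA => (frame_zero fl' PA).2).
(* On [X], substituting [l' 0 = c *: l 0] and [l' 1 = m *: l 0 + n *: l 1] in the second conic
   equation and using the first leaves [l 0] times this form. It also vanishes on the [k - 4] points
   of [A] other than [e], [e']. *)
have M0 : c *: l' 2 + - m ^+ 2 *: l 0 + - (2 * m * n) *: l 1 + - n ^+ 2 *: l 2 = 0.
  apply: (arcS (Y := (A :\ e :\ e') :|: X)).
  - apply/subsetP => P; rewrite !inE => /orP[/and3P[_ _]|/XSP[]//].
    exact: subsetP AS P.
  - rewrite cardsU (_ : _ :&: _ = set0).
      by rewrite cards0 subn0; have := cardsD2 eA eA' nee; move: cA cX; lia.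
    apply/setP => P; rewrite !inE; apply/negP => /andP[/and3P[_ _ PA] /XSP[_]].
    by rewrite PA.
  move=> P; rewrite in_setU => /orP[|PX].
    by rewrite !inE => /and3P[ne' ne PA]; rewrite !evE !Hz ?Hz' ?inE ?ne ?ne' //; ring.
  have x0 := frame_tangent eA fl (subsetP XS _ PX).
  apply: (mulfI x0); rewrite mulr0 !evE.
  have := Hc' _ PX; rewrite E0 E1 !evE => Ex.
  transitivity (c * ev (l 0) P * ev (l' 2) P
    - (m * ev (l 0) P + n * ev (l 1) P) ^+ 2
    + n ^+ 2 * (ev (l 1) P ^+ 2 - ev (l 0) P * ev (l 2) P)); first by ring.
  by rewrite Ex Hc //; ring.
have n0 : n = 0.
  have /eqP := ev0 e; rewrite -M0 !evE He0 He1 Hz' ?inE ?nee //.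
  rewrite !mulr0 !add0r mulf_eq0 (negPf He2) orbF oppr_eq0 expf_eq0 /=.
  by move/eqP.
have /Hi'[_ /eqP] : - m *: l' 0 + c *: l' 1 + 0 *: l' 2 = 0.
  by rewrite E0 E1 n0 !scale0r !addr0 !scalerA -scalerDl mulNr mulrC addNr scale0r.
by rewrite (negPf c0).
Qed.

(** Pigeonhole: [root] would inject the [q + 2] points of [S] into [option F], a projective line
    with [q + 1] points. *)
Lemma no_frames : ~ (forall e, e \in A -> exists l, frame e l).
Proof.
move=> H.
have [L HL] : exists L : I -> nat -> 'cV[F]_k, forall e, e \in A -> frame e (L e).
  have : forall e, exists l, e \in A -> frame e l.
    move=> e; case: (boolP (e \in A)) => [/H[l]|_]; first by exists l.
    by exists (fun _ => 0).
  move/fin_all_exists => [L HL]; by exists L.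
have [e eA] : exists e, e \in A.
  by apply/set0Pn; rewrite -card_gt0; move: cA k3; lia.
have fl := HL e eA; move: (L e) fl => l fl; have [_ _ Hi _] := fl.
have [M HM] : exists M : I -> F * F, forall e', e' \in A ->
    L e' 0%N = (M e').1 *: l 0 + (M e').2 *: l 1.
  have : forall e', exists m : F * F, e' \in A -> L e' 0%N = m.1 *: l 0 + m.2 *: l 1.
    move=> e'; case: (boolP (e' \in A)) => [eA'|_]; last by exists 0.
    have [m [n E]] := frame_span eA fl (fun P PA => (frame_zero (HL e' eA') PA).1).
    by exists (m, n).
  move/fin_all_exists => [M HM]; by exists M.
(* A hyperplane [a *: l 0 + b *: l 1] through [A] is recorded by the ratio of [l 1] to [l 0] on it,
   namely [- a / b], or [None] if [b = 0]. A point of [A] gets its tangent hyperplane, any other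
   point the hyperplane it spans with [A]. *)
pose root P := if P \in A then
    (if (M P).2 == 0 then None else Some (- (M P).1 / (M P).2))
  else Some (ev (l 1) P / ev (l 0) P).
have Hprop e1 e2 c : e1 \in A -> e2 \in A -> L e2 0%N = c *: L e1 0%N -> e1 = e2.
  move=> eA1 eA2 E; apply/eqP/negPn/negP => ne.
  exact: (frame_tangent_neq eA1 eA2 ne (HL _ eA1) (HL _ eA2) E).
have HN e1 : e1 \in A -> (M e1).2 = 0 -> (M e1).1 != 0.
  move=> eA1 n0; apply/eqP => m0; have [_ _ Hi1 _] := HL _ eA1.
  have [|/eqP] := Hi1 1 0 0; last by rewrite oner_eq0.
  by rewrite HM // m0 n0 !scale0r !addr0 scaler0.
(* Equal ratios would put [P] on the tangent hyperplane at [e1]. *)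
have Hmix P e1 : P \in S :\: A -> e1 \in A ->
    Some (ev (l 1) P / ev (l 0) P) <>
    (if (M e1).2 == 0 then None else Some (- (M e1).1 / (M e1).2)).
  move=> PSA eA1; case: ifP => // /negbT n0 [] /eqP.
  have P0 := frame_tangent eA fl PSA; rewrite eqr_div // => /eqP E.
  have := frame_tangent eA1 (HL _ eA1) PSA; rewrite HM // !evE.
  by rewrite [_.2 * _]mulrC E mulNr addrN eqxx.
have rootI : {in S &, injective root}.
  move=> P R PS RS; rewrite /root.
  case: (boolP (P \in A)) => PA; case: (boolP (R \in A)) => RA.
  - case: (eqVneq (M P).2 0) => nP; case: (eqVneq (M R).2 0) => nR // E.
      apply: (Hprop _ _ ((M R).1 / (M P).1)) => //.
      by rewrite !HM // nP nR !scale0r !addr0 scalerA divfK // HN.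
    case: E => /eqP; rewrite eqr_div // => /eqP E.
    apply: (Hprop _ _ ((M R).2 / (M P).2)) => //.
    rewrite !HM // scalerDr !scalerA divfK //; congr (_ *: _ + _).
    apply: (mulIf nP); apply: oppr_inj; rewrite -mulNr -E.
    by field.
  - by move=> E; case: (@Hmix R P); rewrite // !inE RA.
  - by move=> E; case: (@Hmix P R); rewrite // !inE PA.
  have PSA : P \in S :\: A by rewrite inE PA.
  have RSA : R \in S :\: A by rewrite inE RA.
  have P0 := frame_tangent eA fl PSA; have R0 := frame_tangent eA fl RSA.
  move=> [] /eqP; rewrite eqr_div // => /eqP E; apply/eqP/negPn/negP => nPR.
  have /Hi[_ /eqP] : - ev (l 1) P *: l 0 + ev (l 0) P *: l 1 + 0 *: l 2 = 0.
    apply: (arcS (Y := A :|: [set P; R])).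
    - apply/subsetP => T; rewrite !inE => /orP[|/orP[]/eqP-> //].
      exact: subsetP AS T.
    - rewrite cardsU (_ : _ :&: _ = set0) ?cards0 ?subn0 ?cards2 ?nPR ?cA //.
      apply/setP => T; rewrite !inE; apply/negP => /andP[TA /orP[]/eqP ET].
        by move: PA; rewrite -ET TA.
      by move: RA; rewrite -ET TA.
    move=> T; rewrite !inE !evE => /orP[TA|/orP[]/eqP->].
    - by have [-> ->] := frame_zero fl TA; ring.
    - by ring.
    - by rewrite mulNr E; ring.
  by rewrite (negPf P0).
by have := max_card (mem (root @: S)); rewrite card_in_imset // card_option cS addn2 ltnn.
Qed.

End Frames.

(** * From projective points and conics to vectors and frames *)

Lemma two_neq0_odd (F : finFieldType) : odd #|F| -> (2 : F) != 0.
Proof.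
move=> oF; apply/eqP => F20.
(* The additive order of [1] divides both [2] and the odd number [#|F|]. *)
have d2 : (#[1%R : F]%g %| 2)%N by rewrite order_dvdn FinRing.zmodXgE F20.
have dF : (#[1%R : F]%g %| #|F|)%N by rewrite -cardsT order_dvdG // inE.
have : (#[1%R : F]%g %| gcdn 2 #|F|)%N by rewrite dvdn_gcd d2.
have /eqP-> : coprime 2 #|F| by rewrite coprime2n.
by rewrite order_dvdn FinRing.zmodXgE mulr1n; apply/negP; exact: oner_neq0.
Qed.

Section Points.
Variables (F : finFieldType) (k : nat).
Local Notation pt := {vspace 'rV[F]_k}.

Lemma point_line (P : pt) : P \in points 'rV[F]_k -> P = <[vpick P]>%VS.
Proof.
rewrite inE => /eqP dP; apply/esym/eqP; rewrite eqEdim -memvE memv_pick /=.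
by rewrite dP dim_vline vpick0 -dimv_eq0 dP.
Qed.

Lemma arc_eq0 (S Y : {set pt}) (l : 'cV[F]_k) : is_arc S -> Y \subset S ->
    (k <= #|Y|)%N -> (forall P, P \in Y -> ev (@vpick _ _) l P = 0) ->
  l = 0.
Proof.
move=> [Sp Sspan] YS /subset_of_card[Z ZY cZ] lY.
have ZS := subset_trans ZY YS.
have lz (x : 'rV_k) : x *m l = 0.
  have: x \in spanv Z by rewrite (Sspan Z) ?memvf.
  case/memv_sumP => y yP ->; rewrite mulmx_suml big1 // => P PZ.
  have := yP P PZ; rewrite (point_line (subsetP Sp _ (subsetP ZS _ PZ))).
  case/vlineP => c ->; rewrite -scalemxAl; apply/eqP; rewrite scaler_eq0.
  apply/orP; right; apply/eqP/matrixP => i j; rewrite !ord1 [RHS]mxE.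
  by apply: lY; exact: (subsetP ZY).
by rewrite -[l]mul1mx; apply/row_matrixP => i; rewrite row_mul lz row0.
Qed.

(** Otherwise [D], enlarged to a set [Y] of [k - 1] points of [S] avoiding [P], would already span
    the [k]-dimensional space. *)
Lemma arc_notin_span (S D : {set pt}) (P : pt) : is_arc S -> D \subset S ->
    (#|D| < k)%N -> (k <= #|S|)%N -> P \in S -> P \notin D ->
  vpick P \notin spanv D.
Proof.
move=> [Sp Sspan] DS cD cS PS PD; apply/negP => PinD.
have [Z ZS cZ] : exists2 Z : {set pt}, Z \subset S :\: (P |: D) &
    (#|Z| + #|D|)%N = k.-1.
  have [|Z ZS cZ] := @subset_of_card _ (S :\: (P |: D)) (k.-1 - #|D|).
    rewrite cardsD (setIidPr _); last by rewrite subUset sub1set PS.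
    by rewrite cardsU1 PD; move: cD cS; lia.
  by exists Z => //; rewrite cZ subnK // -ltnS (ltn_predK cD).
pose Y := Z :|: D.
have PY : P \notin Y.
  rewrite inE negb_or PD andbT; apply/negP => /(subsetP ZS).
  by rewrite !inE eqxx.
have YS : Y \subset S by rewrite subUset (subset_trans ZS (subsetDl _ _)).
have cY : #|Y| = k.-1.
  rewrite cardsU (_ : Z :&: D = set0) ?cards0 ?subn0 //; apply/setP => R.
  rewrite !inE; apply/negP => /andP[/(subsetP ZS)].
  by rewrite !inE => /andP[/norP[_ /negPf->]].
have PYs : (P <= spanv Y)%VS.
  rewrite (point_line (subsetP Sp _ PS)) -memvE; apply: subvP PinD.
  apply/subv_sumP => R RD; rewrite (sumv_sup R) // inE RD orbT //.
have fullY : spanv Y = fullv.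
  have cPY : #|P |: Y| = k by rewrite cardsU1 PY cY add1n (ltn_predK cD).
  rewrite -(Sspan (P |: Y)) //; last by rewrite subUset sub1set PS.
  by rewrite /spanv big_setU1 //=; apply/esym/addv_idPr.
have := dimv_leq_sum (index_enum pt) (mem Y) id.
rewrite [X in (\dim X <= _)%N]fullY dimvf /dim /= mul1n.
have -> : (\sum_(i in Y) \dim i)%N = #|Y|.
  rewrite -sum1_card; apply: eq_bigr => R RY.
  by have := subsetP Sp _ (subsetP YS _ RY); rewrite inE => /eqP.
by rewrite cY; move: cD; lia.
Qed.

(** The forms are the coordinates of [phi] in the basis given by [conic_coordinates] at the image of
    [e]; surjectivity of [phi] makes them independent. *)
Lemma conic_frame (S G A : {set pt}) (e : pt) :
    odd #|F| -> is_arc S -> G \subset S -> A \subset G -> e \in A ->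
    (#|A| <= k)%N -> (k <= #|S|)%N ->
    projection_in_conic G (A :\ e) ->
  exists l, frame (@vpick _ _) A (G :\: A) e l.
Proof.
move=> oF arcS GS AG eA cA cS [phi [[kphi iphi] [C [M nd ->] pC]]].
have F2 := two_neq0_odd oF.
have [Sp _] := arcS.
have eG := subsetP AG _ eA; have eS := subsetP GS _ eG.
have phi0 P : P \in A :\ e -> phi (vpick P) = 0.
  move=> PA; apply/eqP; rewrite -memv_ker kphi.
  by apply: (subvP (sumv_sup P PA (subvv _))); exact: memv_pick.
have qphi P : P \in G :\: (A :\ e) -> qform M (phi (vpick P)) = 0.
  move=> PG; have : (phi @: P)%VS \in projection phi G (A :\ e) by apply: imset_f.
  move/(subsetP pC); rewrite inE => /andP[_ /forallP/(_ (phi (vpick P)))].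
  by rewrite memv_img ?memv_pick //= => /eqP.
have phie : phi (vpick e) != 0.
  rewrite -memv_ker kphi (arc_notin_span arcS) //.
  - by rewrite (subset_trans (subsetDl _ _)) // (subset_trans AG).
  - by move: cA; rewrite (cardsD1 e A) eA.
  - by rewrite !inE eqxx.
have qe : qform M (phi (vpick e)) = 0 by apply: qphi; rewrite !inE eqxx eG.
have [P Pu [Pe PC]] := conic_coordinates F2 nd phie qe.
pose T := lin1_mx phi *m invmx P.
exists (fun i => col (inord i) T).
have evT i R : ev (@vpick _ _) (col (inord i) T) R
    = (phi (vpick R) *m invmx P) 0 (inord i).
  by rewrite /ev colE !mulmxA mul_rV_lin1 -colE [LHS]mxE.
have o0 : inord 0 = 0 :> 'I_3 by apply/val_inj; rewrite /= inordK.
have o1 : inord 1 = 1 :> 'I_3 by apply/val_inj; rewrite /= inordK.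
have o2 : inord 2 = 2 :> 'I_3 by apply/val_inj; rewrite /= inordK.
have eE : phi (vpick e) *m invmx P = delta_mx 0 2.
  by rewrite -Pe rowE mulmxK.
split.
- by move=> R i RA; rewrite evT phi0 // mul0mx mxE.
- by rewrite !evT eE o0 o1 o2 !mxE /= oner_eq0.
- move=> c0 c1 c2; rewrite o0 o1 o2 => E.
  pose c : 'cV[F]_3 := \col_i [:: c0; c1; c2]`_i.
  have mulE (U : 'M_(k, 3)) :
      U *m c = c0 *: col 0 U + c1 *: col 1 U + c2 *: col 2 U.
    apply/matrixP => i j; rewrite !mxE !big_ord_recl big_ord0 !mxE /= addr0 addrA.
    rewrite mulrC [_ * c1]mulrC [_ * c2]mulrC.
    by congr (_ * _ + _ * _ + _ * _); congr (U _ _); apply/val_inj.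
  have Tc : T *m c = 0 by rewrite mulE.
  have c0' : c = 0.
    rewrite -[c]mul1mx -(mulmxV Pu); apply/row_matrixP => i.
    rewrite !row_mul row0; have : row i P \in limg phi by rewrite iphi memvf.
    case/memv_imgP => x _ ->.
    by rewrite -mul_rV_lin1 -(mulmxA x) -(mulmxA x) -/T Tc mulmx0.
  have cE (i : 'I_3) : [:: c0; c1; c2]`_i = 0.
    by have /matrixP/(_ i 0) := c0'; rewrite !mxE.
  by split; [exact: (cE 0) | exact: (cE 1) | exact: (cE 2)].
- move=> x; rewrite !inE => /andP[xA xG]; rewrite !evT o0 o1 o2; apply: PC.
  by rewrite mulmxKV // qphi // !inE (negPf xA) andbF.
Qed.
End Points.

Local Close Scope ring_scope.

Theorem theorem1p3 (q k : nat) (F : finFieldType)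
    (hF : #|F| = q) (hq : odd q) (hk : 0 < k)
    (G E : {set {vspace 'rV[F]_k}})
    (hG : is_arc G) (hGcard : #|G| + 6 = 3 * k)
    (hEG : E \subset G) (hEcard : #|E| + 3 = 2 * k)
    (hproj : forall D : {set {vspace 'rV[F]_k}},
        D \subset E -> #|D| + 3 = k -> projection_in_conic G D) :
  ~ (exists A : {set {vspace 'rV[F]_k}},
        [/\ is_arc A, #|A| = q + 2 & G \subset A]).
Proof.
move=> [S [arcS cS GS]].
(* From [E \subset G] one gets [2 k - 3 <= 3 k - 6]. *)
have k3 : (2 < k)%N by have := subset_leq_card hEG; move: hGcard hEcard; lia.
have [|A AE cA] := @subset_of_card _ E (k - 2); first by move: hEcard; lia.
have AG := subset_trans AE hEG.
(* Thus [G :\: A] has [2 t + 2] points for [t = k - 3], as the interpolation requires. *)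
have cX : (#|G :\: A| + 4 = 2 * k)%N.
  by rewrite cardsD (setIidPr AG) cA; move: hGcard; lia.
rewrite -hF in hq cS.
have kS : (k <= #|S|)%N by have := subset_leq_card GS; move: hGcard; lia.
apply: (no_frames (v := @vpick _ _) (S := S) (A := A) (X := G :\: A)) => //.
- by move=> Y l; exact: arc_eq0.
- exact: two_neq0_odd.
- exact: subset_trans GS.
- exact: setSD.
- by rewrite cA subnK // ltnW.
move=> e eA; apply: (conic_frame hq arcS GS AG eA) => //.
  by rewrite cA leq_subr.
apply: hproj; first by rewrite (subset_trans (subsetDl _ _)).
by rewrite -[RHS](subnK (ltnW k3)) -cA (cardsD1 e A) eA add1n addSnnS.
Qed.
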